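(* There is a dense set $\Delta\subset(0,1)$ with the following property. For each $\alpha\in\Delta$ there is a self-affine function $f_\alpha\in C^{\alpha}[0,1]$ such that for all $A\subset[0,1]$: (1) if $f_\alpha|_A\in C^{\beta}(A)$ for some $\beta>\alpha$, then $\overline{\dim}_{\mathcal M}A\le1-\alpha$; (2) if $V^{\beta}(f_\alpha|_A)<\infty$ for some $\beta>0$, then $\overline{\dim}_{\mathcal M}A\le\max\{1-\alpha,\alpha\beta\}$.
   Context: For non-empty $A\subset[0,1]$ and $\beta>0$, $C^{\beta}(A)$ is the set of $\beta$-Hölder continuous functions $f\colon A\to\mathbb R$, i.e. those for which there is $c\in(0,\infty)$ with $|f(x)-f(y)|\le c|x-y|^{\beta}$ for all $x,y\in A$; $C^{\alpha}[0,1]$ is the case $A=[0,1]$. The $\beta$-variation of $f\colon A\to\mathbb R$ is \[ V^{\beta}(f)=\sup\left\{\sum_{i=1}^{n}|f(x_i)-f(x_{i-1})|^{\beta}:\ x_0<\dots<x_n,\ x_i\in A,\ n\in\mathbb N^+\right\}. \] A compact set $K\subset\mathbb R^2$ is self-affine if for some $M\ge2$ there are injective and contractive affine maps $F_1,\dots,F_M\colon\mathbb R^2\to\mathbb R^2$ such that $K=\bigcup_{i=1}^{M}F_i(K)$. A continuous function $f\colon[0,1]\to\mathbb R$ is self-affine if its graph is a self-affine set. $\overline{\dim}_{\mathcal M}$ is the upper Minkowski (upper box) dimension: for an integer $M\ge2$, $\overline{\dim}_{\mathcal M}A=\limsup_{n\to\infty}\frac{\log N_n(A,M)}{n\log M}$,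 where $N_n(A,M)$ is the number of intervals $[pM^{-n},(p+1)M^{-n})$, $p\in\{0,\dots,M^n-1\}$, that intersect $A$ (the value does not depend on $M$). *)

(* Defs.v *)
From HB Require Import structures.
From mathcomp Require Export all_boot all_order all_algebra.
From mathcomp Require Export all_classical all_reals all_analysis.
Export Order.TTheory GRing.Theory Num.Theory numFieldNormedType.Exports.

#[export] Set Implicit Arguments.
#[export] Unset Strict Implicit.
#[export] Unset Printing Implicit Defensive.

Local Open Scope classical_set_scope.
Local Open Scope ring_scope.

(* Functions on a subset of R are represented by total functions R -> R, of
   which only the values on that subset are used. *)

Definition holder_on (R : realType) (A : set R) (beta : R) (f : R -> R) : Prop :=
  exists2 c : R, 0 < c &
    forall x y, A x -> A y -> `|f x - f y| <= c * `|x - y| `^ beta.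

(* Only x 0, ..., x n matter; the value is -oo if A has fewer than two points. *)
Definition beta_variation (R : realType) (beta : R) (A : set R) (f : R -> R) :
    \bar R :=
  ereal_sup [set s | exists n (x : nat -> R),
    [/\ (0 < n)%N,
        forall i, (i < n)%N -> x i < x i.+1,
        forall i, (i <= n)%N -> A (x i) &
        s = (\sum_(i < n) `|f (x i.+1) - f (x i)| `^ beta)%:E]].

(* The norm that MathComp-Analysis puts on matrices is the sup norm. *)
Definition euclidean_norm (R : realType) (v : 'cV[R]_2) : R :=
  Num.sqrt (\sum_i v i 0 ^+ 2).

Definition affine_map (R : realType) (F : 'cV[R]_2 -> 'cV[R]_2) : Prop :=
  exists (L : 'M[R]_2) (b : 'cV[R]_2), forall v, F v = L *m v + b.

Definition contractive_map (R : realType) (F : 'cV[R]_2 -> 'cV[R]_2) : Prop :=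
  exists q : R, 0 <= q < 1 /\
    forall u v, euclidean_norm (F u - F v) <= q * euclidean_norm (u - v).

Definition self_affine_set (R : realType) (K : set 'cV[R]_2) : Prop :=
  compact K /\
  exists (M : nat) (F : 'I_M -> 'cV[R]_2 -> 'cV[R]_2),
    [/\ (2 <= M)%N,
        forall i, [/\ injective (F i), contractive_map (F i) & affine_map (F i)] &
        K = \bigcup_i (F i @` K)].

Definition unit_graph (R : realType) (f : R -> R) : set 'cV[R]_2 :=
  [set v | v 0 0 \in `[0, 1] /\ v 1 0 = f (v 0 0)].

Definition self_affine_function (R : realType) (f : R -> R) : Prop :=
  {within `[0, 1], continuous f} /\ self_affine_set (unit_graph f).

Definition adic_count (R : realType) (M n : nat) (A : set R) : nat :=
  #|[pred p : 'I_(M ^ n) |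
      `[< A `&` `[p%:R / M%:R ^+ n, p.+1%:R / M%:R ^+ n[ !=set0 >] ]|.

(* lne 0 = -oo, so the value is -oo when no half-open M-adic interval is hit. *)
Definition upper_minkowski_dim (R : realType) (M : nat) (A : set R) : \bar R :=
  limn_esup (fun n : nat =>
    (lne (adic_count M n A)%:R%:E * ((n%:R * ln M%:R)^-1)%:E)%E).

(* Main.v *)
Require Import Defs.
From mathcomp Require Import ring lra zify.

(** Fix an integer [m > 1] and an odd integer [r], and let [n = m * r].  The
    zigzag function [f] climbs from [0] to [1] in [n] steps of width [1 / n] and
    height [1 / m]: it crosses each of the [m] horizontal strips of height
    [1 / m] exactly [r] times, alternately upwards and downwards, and since [r]
    is odd it leaves every strip at the top, where the next strip begins.  Each
    step is then replaced by a copy of the whole graph, turned upside down for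
    the downward steps.  So the graph is self-affine, and [f] maps every
    [n]-adic cell of level [k] onto an interval of length [m ^ -k], which makes
    [f] Hölder with the exponent [alpha] such that [n ^ alpha = m].  With
    [m = 3 ^ a] and [r = 3 ^ b] the exponent is [a / (a + b)], so every rational
    number strictly between 0 and 1 occurs.

    The dimension bounds come from the number [N k] of cells of level [k] that
    meet [A].  Fix [l], and take a cell of level [k] on which [f] restricted to
    [A] oscillates by less than [m ^ -(k + l)].  The values of [f] on this part
    of [A] lie so close to a single value that they meet at most three strips of
    height [m ^ -(k + l)], and inside the cell each strip is crossed by exactly
    [r ^ l] of the [n ^ l] subcells of level [k + l].  Hence
    [N (k + l) <= 3 * r ^ l * N k + n ^ l * B k], where [B k] counts the cells in
    which two values on [A] differ by at least [m ^ -(k + l)]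
    ([zigzag_adic_count_rec]).  Regularity of the restriction bounds [B k] by a
    multiple of [m ^ (k * gamma)]: with [gamma = 0] if the restriction is Hölder
    with an exponent [beta > alpha], because then [B k] vanishes for large [k]
    ([holder_oscillation]), and with [gamma = beta] if its [beta]-variation is
    finite, because one jump can be selected in each cell counted by [B k]
    ([beta_variation_oscillation]).

    Since [r = n ^ (1 - alpha)] and [m ^ gamma = n ^ (alpha * gamma)], for every
    [d > max (1 - alpha) (alpha * gamma)] and [l] large enough the factor
    [3 * r ^ l] is at most half of [n ^ (l * d)], and the recursion gives
    [N k = O (n ^ (k * d))] along the multiples of [l]
    ([zigzag_adic_count_le]).  Passing to another base costs a factor two
    ([adic_count_change_base]), so the upper Minkowski dimension is at most
    [d] in every base ([upper_minkowski_dim_le_powers]). *)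

Local Open Scope classical_set_scope.
Local Open Scope ring_scope.

(** * Columns, rows and slots of the zigzag *)

(** Reading the base [n] digits of [p] from the most significant one, where a
    digit [i] stands for the [i]-th step of the zigzag, [column_row] is the
    number of the horizontal strip crossed over the [p]-th column of level [k],
    [column_flip] tells whether it is crossed downwards, and [column_slot]
    numbers the columns that cross the same strip. *)
Section ColumnRows.
Variables (m r : nat).
Hypotheses (m_gt1 : (1 < m)%N) (r_gt0 : (0 < r)%N).

Let n := (m * r)%N.

Let m_gt0 : (0 < m)%N. Proof. exact: ltnW. Qed.
Let n_gt0 : (0 < n)%N. Proof. by rewrite muln_gt0 m_gt0. Qed.

Fixpoint column_flip (k p : nat) : bool :=
  if k is k'.+1 then
    odd ((p %/ n ^ k') %% r) (+) column_flip k' (p %% n ^ k')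
  else false.

Fixpoint column_row (k p : nat) : nat :=
  if k is k'.+1 then
    let i := (p %/ n ^ k')%N in
    let row := column_row k' (p %% n ^ k') in
    (i %/ r * m ^ k' + if odd (i %% r) then (m ^ k').-1 - row else row)%N
  else 0%N.

Fixpoint column_slot (k p : nat) : nat :=
  if k is k'.+1 then
    ((p %/ n ^ k') %% r * r ^ k' + column_slot k' (p %% n ^ k'))%N
  else 0%N.

Lemma column_row_lt k p : (p < n ^ k)%N -> (column_row k p < m ^ k)%N.
Proof.
elim: k p => [|k IH] p //= plt.
have nk0 : (0 < n ^ k)%N by rewrite expn_gt0 n_gt0.
have mk0 : (0 < m ^ k)%N by rewrite expn_gt0 m_gt0.
have /IH lt := ltn_pmod p nk0.
have : (p %/ n ^ k %/ r < m)%N by rewrite !ltn_divLR// -/n -expnS.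
set i := (_ %/ r)%N; move: lt; set c := column_row _ _ => lt ilt.
rewrite expnS (@leq_trans (i.+1 * m ^ k)%N) ?leq_mul2r ?ilt ?orbT//.
by rewrite mulSn addnC ltn_add2r; case: ifP => // _; lia.
Qed.

Lemma column_slot_lt k p : (p < n ^ k)%N -> (column_slot k p < r ^ k)%N.
Proof.
elim: k p => [|k IH] p //= plt.
have nk0 : (0 < n ^ k)%N by rewrite expn_gt0 n_gt0.
have /IH lt := ltn_pmod p nk0.
rewrite expnS (@leq_trans (((p %/ n ^ k) %% r).+1 * r ^ k)%N)//.
  by rewrite mulSn addnC ltn_add2r.
by rewrite leq_mul2r ltn_pmod ?orbT.
Qed.

Lemma radix_inj (b q q' c c' : nat) : (c < b)%N -> (c' < b)%N ->
  (q * b + c = q' * b + c')%N -> q = q' /\ c = c'.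
Proof.
move=> cb c'b E; have b0 : (0 < b)%N by exact: leq_ltn_trans cb.
have := congr1 (divn^~ b) E; have := congr1 (modn^~ b) E.
by rewrite !modnMDl !modn_small// !divnMDl// !divn_small// !addn0.
Qed.

(** The strip and the slot determine all the digits of [p]: a leading digit
    [i] is recovered from [i %/ r], the leading digit of the row, and from
    [i %% r], the leading digit of the slot, and the parity of [i %% r] tells
    whether the rest of the row is to be read backwards. *)
Lemma column_row_slot_inj k p q : (p < n ^ k)%N -> (q < n ^ k)%N ->
  column_row k p = column_row k q -> column_slot k p = column_slot k q -> p = q.
Proof.
elim: k p q => [|k IH] p q.
  by rewrite expn0 !ltnS !leqn0 => /eqP -> /eqP ->.
move=> plt qlt /= Er Es.
have nk0 : (0 < n ^ k)%N by rewrite expn_gt0 n_gt0.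
have mk0 : (0 < m ^ k)%N by rewrite expn_gt0 m_gt0.
have pl := ltn_pmod p nk0; have ql := ltn_pmod q nk0.
have [Ei Es'] := radix_inj (column_slot_lt pl) (column_slot_lt ql) Es.
have rp := column_row_lt pl; have rq := column_row_lt ql.
have lt c (b : bool) : (c < m ^ k)%N ->
    ((if b then (m ^ k).-1 - c else c) < m ^ k)%N.
  by case: b => // _; lia.
have [Ej Er'] := radix_inj (lt _ _ rp) (lt _ _ rq) Er.
have Er'' : column_row k (p %% n ^ k) = column_row k (q %% n ^ k).
  by move: Er'; rewrite Ei; case: ifP => // _; lia.
have Em := IH _ _ pl ql Er'' Es'.
rewrite (divn_eq p (n ^ k)) (divn_eq q (n ^ k)) Em; congr (_ * _ + _)%N.
by rewrite (divn_eq (p %/ n ^ k) r) (divn_eq (q %/ n ^ k) r) Ej Ei.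
Qed.

(** Slots of level [k] are less than [r ^ k], so by injectivity each of the
    three consecutive rows [c - 1], [c] and [c + 1] is taken by at most [r ^ k]
    columns.  The rows are shifted by one because [c - 1] may be negative. *)
Lemma count_columns_near_row (P : pred nat) (k c : nat) :
  (forall p, (p < n ^ k)%N -> P p -> (c <= (column_row k p).+1 < c + 3)%N) ->
  (\sum_(0 <= p < n ^ k) P p <= 3 * r ^ k)%N.
Proof.
move=> near_c.
have rk0 : (0 < r ^ k)%N by rewrite expn_gt0 r_gt0.
rewrite big_mkord.
have -> : (\sum_(p < n ^ k) P p)%N = #|[pred p : 'I_(n ^ k) | P p]|.
  rewrite -sum1_card [RHS]big_mkcond; apply: eq_bigr => p _.
  by rewrite inE; case: (P p).
(* The remainders only serve to land in the ordinals: on columns that satisfy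
   [P], the first argument is less than 3 and the second less than [r ^ k]. *)
pose code (p : 'I_(n ^ k)) :=
  (Ordinal (ltn_pmod ((column_row k p).+1 - c) (isT : 0 < 3)%N),
   Ordinal (ltn_pmod (column_slot k p) rk0)).
have code_inj : {in [pred p : 'I_(n ^ k) | P p] &, injective code}.
  move=> p q; rewrite !inE => /(near_c _ (ltn_ord p)) hp.
  move=> /(near_c _ (ltn_ord q)) hq [E1 E2].
  have [hp3 hq3] :
      ((column_row k p).+1 - c < 3)%N /\ ((column_row k q).+1 - c < 3)%N.
    by split; lia.
  move: E1 E2; rewrite !modn_small ?column_slot_lt// => E1 E2.
  apply/val_inj/(column_row_slot_inj (ltn_ord p) (ltn_ord q)) => //.
  by move: hp hq E1; clear; lia.
rewrite -(card_in_image code_inj) (leq_trans (max_card _))//.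
by rewrite card_prod !card_ord.
Qed.
End ColumnRows.

(** * Graphs of Hölder functions *)

Lemma holder_within_continuous (R : realType) (A : set R) (beta : R)
    (f : R -> R) :
  0 < beta -> holder_on A beta f -> {within A, continuous f}.
Proof.
move=> b0 [c c0 hc]; apply/subspace_continuousP => x Ax.
apply/cvgrPdist_lt => e e0.
(* The radius solves [c * d ^ beta = e]. *)
have d0 : 0 < (e / c) `^ beta^-1 by rewrite powR_gt0 ?divr_gt0.
apply/nbhs_ballP; exists ((e / c) `^ beta^-1) => //= y.
rewrite -ball_normE /= => xy Ay.
rewrite (le_lt_trans (hc _ _ Ax Ay))// mulrC -ltr_pdivlMr//.
have -> : e / c = ((e / c) `^ beta^-1) `^ beta.
  by rewrite -powRrM mulVf ?gt_eqF// powRr1// ltW// divr_gt0.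
by apply: gt0_ltr_powR; rewrite ?nnegrE// ltW.
Qed.

Lemma continuous_compact_unit_graph (R : realType) (f : R -> R) :
  {within `[0, 1], continuous f} -> compact (unit_graph f).
Proof.
move=> cf; pose g x : 'cV[R]_2 := \col_a (if a == 0 then x else f x).
have -> : unit_graph f = g @` `[0, 1].
  apply/seteqP; split => v /=.
    move=> [v0 v1]; exists (v 0 0) => //.
    apply/colP => a; rewrite mxE; case: a => [[|[|a]] ha] //=.
      by congr (v _ _); apply/val_inj.
    by rewrite -v1; congr (v _ _); apply/val_inj.
  by move=> [x xI <-]; rewrite /unit_graph/= !mxE.
apply: continuous_compact; last exact: segment_compact.
apply/subspace_continuousP => x xI; apply/cvg_ballP => e e0.
move/subspace_continuousP/(_ x xI)/cvg_ballP/(_ e e0) : cf => fe.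
have xe : \forall y \near within `[0, 1] (nbhs x), ball x e y.
  by rewrite near_withinE; apply: filterS (nbhsx_ballx x e e0) => y.
near=> y; split => // a b; rewrite !mxE; case: ifP => _.
  by near: y.
by near: y.
Unshelve. all: by end_near. Qed.

(** * Counting adic cells *)

Section AdicCounting.
Variable R : realType.
Implicit Type A : set R.

Definition adic_cell (M k p : nat) : set R :=
  `[p%:R / M%:R ^+ k, p.+1%:R / M%:R ^+ k[.

Lemma adic_cellP M k p (x : R) : (0 < M)%N ->
  adic_cell M k p x <-> p%:R <= M%:R ^+ k * x < p%:R + 1.
Proof.
move=> M0; have Mk : 0 < M%:R ^+ k :> R by rewrite exprn_gt0// ltr0n.
by rewrite /adic_cell /= in_itv /= ler_pdivrMr// ltr_pdivlMr// mulrC natr1.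
Qed.

Lemma adic_countE M k A :
  adic_count M k A =
    (\sum_(0 <= p < M ^ k) `[< A `&` adic_cell M k p !=set0 >])%N.
Proof.
rewrite /adic_count -sum1_card big_mkord big_mkcond; apply: eq_bigr => p _.
by rewrite inE /adic_cell; case: (`[< _ >]).
Qed.

(** A cell of side at most [M ^ -p] meets at most two consecutive cells of side
    [M ^ -p], and these are told apart by the parity of their numbers. *)
Lemma adic_count_change_base M N p k A : (0 < M)%N -> (0 < N)%N ->
  A `<=` `[0, 1] -> (M ^ p <= N ^ k)%N ->
  (adic_count M p A <= 2 * adic_count N k A)%N.
Proof.
move=> M0 N0 A01 MN.
have Nk0 : (0 < N ^ k)%N by rewrite expn_gt0 N0.
pose hit (P : 'I_(M ^ p)) := `[< A `&` adic_cell M p P !=set0 >].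
pose pt (P : 'I_(M ^ p)) := xget 0 (A `&` adic_cell M p P).
have ptP P : hit P -> A (pt P) /\ P%:R <= M%:R ^+ p * pt P < P%:R + 1.
  move=> /asboolP hP; have [Apt /adic_cellP-/(_ M0) h] := xgetPex 0 hP.
  by split.
have MR : 0 < M%:R ^+ p :> R by rewrite exprn_gt0// ltr0n.
have NR : 0 < N%:R ^+ k :> R by rewrite exprn_gt0// ltr0n.
have MNR : M%:R ^+ p <= N%:R ^+ k :> R by rewrite -!natrX ler_nat.
pose idx P := Num.truncn (N%:R ^+ k * pt P).
have idxP P : hit P -> (idx P < N ^ k)%N /\
    (idx P)%:R <= N%:R ^+ k * pt P < (idx P)%:R + 1.
  move=> /ptP[/A01]; rewrite /= in_itv /= => /andP[x0 _] /andP[_ lt].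
  have h : 0 <= N%:R ^+ k * pt P by rewrite mulr_ge0// ltW.
  rewrite natr1 truncn_itv//; split => //.
  rewrite truncn_lt_nat// natrX gtr_pMr//.
  rewrite -(@ltr_pM2l _ (M%:R ^+ p))// mulr1 (lt_le_trans lt)//.
  by rewrite natr1 -natrX ler_nat.
(* On cells that are met, [idx P] is less than [N ^ k] and the remainder changes
   nothing. *)
pose code P := (Ordinal (ltn_pmod (idx P) Nk0), odd P).
have close P P' : hit P -> hit P' -> idx P = idx P' -> (P < P' + 2)%N.
  move=> hP hP' E.
  have [_ /andP[p1 _]] := ptP _ hP; have [_ /andP[_ p2]] := ptP _ hP'.
  have [_ /andP[_ i1]] := idxP _ hP; have [_ /andP[i2 _]] := idxP _ hP'.
  rewrite E in i1.
  have lt : N%:R ^+ k * (pt P - pt P') < 1 by rewrite mulrBr; lra.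
  rewrite -(ltr_nat R) natrD.
  suff : M%:R ^+ p * (pt P - pt P') < 1 by rewrite mulrBr; lra.
  have [le0|gt0] := leP (pt P - pt P') 0.
    by rewrite (le_lt_trans _ ltr01)// pmulr_rle0.
  by rewrite (le_lt_trans _ lt)// ler_wpM2r// ltW.
have code_inj : {in hit &, injective code}.
  move=> P P' hP hP' [E1 E2]; apply/val_inj => /=.
  rewrite !modn_small in E1; [|exact: (proj1 (idxP _ _))..].
  have := close _ _ hP hP' E1; have := close _ _ hP' hP (esym E1).
  by move: E2; clear; lia.
rewrite /adic_count -[leqLHS](card_in_image code_inj).
rewrite mulnC -card_bool -cardX; apply: subset_leq_card.
apply/fintype.subsetP => _ /fintype.imageP[P hP ->]; rewrite inE /= andbT inE.
have [lt idxI] := idxP _ hP.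
 exists (pt P); split; first by have [] := ptP _ hP.
by apply/(adic_cellP _ _ _ N0); rewrite /= modn_small.
Qed.

(** Two points are asked for, and not a bound on a supremum, so that the jump to
    be used in a variation sum is at hand, while the negation bounds all
    differences strictly. *)
Definition oscillates (f : R -> R) (n k : nat) A (h : R) (p : nat) : Prop :=
  exists x y, [/\ A x, A y, adic_cell n k p x, adic_cell n k p y &
                  h <= `|f x - f y|].

Definition oscillation_count (f : R -> R) (n k : nat) A (h : R) : nat :=
  (\sum_(0 <= p < n ^ k) `[< oscillates f n k A h p >])%N.

Lemma oscillation_count_le f n k A h : (oscillation_count f n k A h <= n ^ k)%N.
Proof.
rewrite -[leqRHS]muln1 -[(n ^ k)%N in leqRHS]subn0 -sum_nat_const_nat.
by apply: leq_sum => p _; exact: leq_b1.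
Qed.
End AdicCounting.

(** * Oscillation and regularity *)

Section OscillationBounds.
Variable R : realType.
Implicit Types (A : set R) (f : R -> R).

Lemma oscillates_sorted f n k A h p : 0 < h -> oscillates f n k A h p ->
  exists x y, [/\ A x, A y, adic_cell n k p x, adic_cell n k p y &
                  x < y /\ h <= `|f y - f x|].
Proof.
move=> h0 [x [y [Ax Ay xp yp hxy]]].
have [lt|lt|xy] := ltgtP x y.
- by exists x, y; rewrite distrC.
- by exists y, x.
- by move: hxy; rewrite xy subrr normr0 leNgt h0.
Qed.

(** The two points of a jump of size [h], chosen in each oscillating cell, form
    one increasing chain, because the cells are disjoint and listed in
    increasing order.  The increments between consecutive cells only add
    nonnegative terms.  The bound on the last point [x N] is what allows the
    chain to be continued in the next cell. *)
Lemma oscillating_cells_chain f n k A h (beta : R) (P : nat) :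
  (0 < n)%N -> 0 < h -> 0 < beta ->
  (\sum_(0 <= p < P) `[< oscillates f n k A h p >])%N = 0%N \/
  exists N (x : nat -> R),
    [/\ (0 < N)%N, forall i, (i < N)%N -> x i < x i.+1,
        forall i, (i <= N)%N -> A (x i),
        n%:R ^+ k * x N < P%:R &
        h `^ beta * (\sum_(0 <= p < P) `[< oscillates f n k A h p >])%N%:R <=
        \sum_(i < N) `|f (x i.+1) - f (x i)| `^ beta].
Proof.
move=> n0 h0 b0; elim: P => [|P IH]; first by left; rewrite big_nil.
have nk0 : 0 < n%:R ^+ k :> R by rewrite exprn_gt0// ltr0n.
rewrite big_nat_recr//=.
have [/asboolP osc|_] := boolP (`[< oscillates f n k A h P >]); last first.
  case: IH => [->|[N [x [N0 xs xA xP xh]]]]; first by left.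
  right; exists N, x; split => //; last by rewrite addn0.
  by rewrite (lt_trans xP)// ltr_nat.
have [u [v [Au Av uP vP [uv huv]]]] := oscillates_sorted h0 osc.
have /adic_cellP-/(_ n0)/andP[uP1 _] := uP.
have /adic_cellP-/(_ n0)/andP[_ vP2] := vP.
have step : h `^ beta <= `|f v - f u| `^ beta.
  by apply: ge0_ler_powR; rewrite ?nnegrE// ltW.
right; case: IH => [->|[N [x [N0 xs xA xP xh]]]].
  exists 1%N, (fun i => if i == 0%N then u else v); split => //.
  - by move=> [|i].
  - by move=> [|i].
  - by rewrite /= -natr1.
  - by rewrite big_ord1 /= mulr1.
(* Two points are appended to the chain, hence two increments; only the second
   one is used. *)
exists N.+2, (fun i => if (i <= N)%N then x i else if i == N.+1 then u else v).
split => //.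
- move=> i iN2; have [->|->|iN] : [\/ i = N.+1, i = N | (i < N)%N].
  + by have [|] := ltnP i N; [constructor 3|move=> ?; have [|] := eqVneq i N;
      [constructor 2|constructor 1; lia]].
  + by rewrite ltnn eqxx ltnNge leqnSn /= gtn_eqF.
  + by rewrite leqnn ltnn eqxx -(ltr_pM2l nk0) (lt_le_trans xP).
  + by rewrite (ltnW iN) iN xs.
- by move=> i _; case: ifP => [/xA//|_]; case: ifP.
- by rewrite ltnNge leqnSn /= gtn_eqF//= -natr1.
- rewrite addn1 -natr1 mulrDr mulr1 !big_ord_recr /=.
  rewrite ltnn eqxx leqnn ltnNge leqnSn /= gtn_eqF//.
  apply: lerD => //; rewrite -[leLHS]addr0; apply: lerD; last exact: powR_ge0.
  rewrite (le_trans xh)// le_eqVlt; apply/orP; left; apply/eqP.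
  by apply: eq_bigr => i _; rewrite (ltn_ord i) (ltnW (ltn_ord i)).
Qed.

(** The chain of jumps gives one of the sums of which the variation is the
    supremum.  If there are no such sums the variation is [-oo], but then no cell
    oscillates and [0] is a bound. *)
Lemma beta_variation_oscillation f A (beta : R) n : (0 < n)%N -> 0 < beta ->
  (beta_variation beta A f < +oo)%E ->
  exists2 C, 0 <= C & forall k h, 0 < h ->
    h `^ beta * (oscillation_count f n k A h)%:R <= C.
Proof.
move=> n0 b0 Vfin; exists (Num.max 0 (fine (beta_variation beta A f))).
  by rewrite le_max lexx.
move=> k h h0; rewrite le_max /oscillation_count.
have [->|[N [x [N0 xs xA _ xh]]]] :=
    oscillating_cells_chain f k A (n ^ k) n0 h0 b0.
  by rewrite mulr0 lexx.
apply/orP; right; apply: (le_trans xh).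
set s := \sum_(i < N) _.
have sV : (s%:E <= beta_variation beta A f)%E.
  by apply: ereal_sup_ubound; exists N, x.
rewrite -lee_fin fineK// fin_numE; apply/andP; split; last by rewrite lt_eqF.
by rewrite gt_eqF// (lt_le_trans _ sV)// ltNyr.
Qed.

(** Points of one cell are at distance at most [n ^ -k], which the Hölder
    estimate turns into a distance of values less than [h]. *)
Lemma holder_oscillation f A (beta c : R) n k h : (0 < n)%N ->
  0 < beta -> 0 <= c ->
  (forall x y, A x -> A y -> `|f x - f y| <= c * `|x - y| `^ beta) ->
  c * (n%:R ^- k) `^ beta < h -> oscillation_count f n k A h = 0%N.
Proof.
move=> n0 b0 c0 hc lt; rewrite /oscillation_count big_nat big1// => p _.
apply/eqP; rewrite eqb0; apply/asboolP => -[x [y [Ax Ay xp yp hxy]]].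
have nk0 : 0 < n%:R ^+ k :> R by rewrite exprn_gt0// ltr0n.
have /adic_cellP-/(_ n0)/andP[x1 x2] := xp.
have /adic_cellP-/(_ n0)/andP[y1 y2] := yp.
have xy : `|x - y| <= n%:R ^- k.
  rewrite -(@ler_pM2l _ (n%:R ^+ k))// divff ?gt_eqF//.
  rewrite -[X in X * _]gtr0_norm// -normrM mulrBr ler_norml.
  by apply/andP; split; lra.
suff : h < h by rewrite ltxx.
rewrite (le_lt_trans hxy)// (le_lt_trans (hc _ _ Ax Ay))// (le_lt_trans _ lt)//.
rewrite ler_wpM2l//; apply: ge0_ler_powR; rewrite ?nnegrE ?(ltW b0)//.
Qed.

End OscillationBounds.

(** * Growth of counts and dimension *)

Section GrowthAndDimension.
Variable R : realType.
Implicit Type A : set R.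

Lemma exprn_powR (x d : R) k : 0 <= x ->
  (x ^+ k) `^ d = (x `^ d) ^+ k.
Proof.
by move=> x0; rewrite -(powR_mulrn k x0) powRAC powR_mulrn// powR_ge0.
Qed.

Lemma expr_eventually_gt (x y : R) : 1 < x ->
  exists k0 : nat, forall k, (k0 <= k)%N -> y < x ^+ k.
Proof.
move=> x1; have x0 : 0 < x by exact: lt_trans x1.
have lx : 0 < ln x by rewrite ln_gt0.
exists (Num.truncn (ln (Num.max y 1) / ln x)).+1 => k kk.
have y0 : 0 < Num.max y 1 by rewrite lt_max ltr01 orbT.
rewrite (@le_lt_trans _ _ (Num.max y 1)) ?le_max ?lexx//.
rewrite -ltr_ln ?posrE ?exprn_gt0// lnXn// -[ltRHS]mulr_natl -ltr_pdivrMr//.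
by rewrite (lt_le_trans (truncnS_gt _))// ler_nat.
Qed.

(** The constant [C] contributes [ln C / (p * ln M)] to the quotient of level
    [p], which is at most [e] as soon as [p >= ln C / (e * ln M)]. *)
Lemma upper_minkowski_dim_le (M : nat) A (d C : R) : (2 <= M)%N -> 0 < C ->
  (forall p, (adic_count M p A)%:R <= C * (M%:R ^+ p) `^ d) ->
  (upper_minkowski_dim M A <= d%:E)%E.
Proof.
move=> M2 C0 hC; apply/lee_addgt0Pr => e e0.
have lM : 0 < ln (M%:R : R) by rewrite ln_gt0// ltr1n.
have M0 : 0 < M%:R :> R by rewrite ltr0n; exact: ltnW.
pose p0 := (Num.truncn (ln C / (e * ln M%:R))).+1.
rewrite /upper_minkowski_dim /limn_esup limf_esupE.
apply: (@le_trans _ _ (ereal_sup [set (lne (adic_count M p A)%:R%:E *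
    ((p%:R * ln M%:R)^-1)%:E)%E | p in [set p | (p0 <= p)%N]])).
  by apply: ereal_inf_lbound; exists [set p | (p0 <= p)%N] => //; exists p0.
apply: ub_ereal_sup => _ [p pp <-]; have {}pp : (p0 <= p)%N := pp.
have p1 : 0 < p%:R :> R by rewrite ltr0n (leq_trans _ pp).
have pl : 0 < p%:R * ln M%:R :> R by rewrite mulr_gt0.
have [->|N0] := posnP (adic_count M p A).
  by rewrite /= lexx mulNyr gtr0_sg ?invr_gt0// mul1e leNye.
have N0R : 0 < (adic_count M p A)%:R :> R by rewrite ltr0n.
rewrite lne_EFin// -EFinM -EFinD lee_fin ler_pdivrMr//.
have := hC p; rewrite -ler_ln ?posrE ?mulr_gt0 ?powR_gt0 ?exprn_gt0//.
move=> /le_trans; apply.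
rewrite lnM ?posrE ?powR_gt0 ?exprn_gt0// ln_powR lnXn// -[ln _ *+ p]mulr_natl.
rewrite mulrDl addrC lerD2l.
have h : ln C / (e * ln M%:R) <= p%:R.
  by rewrite (le_trans (ltW (truncnS_gt _)))// ler_nat.
by rewrite ler_pdivrMr ?mulr_gt0// in h; rewrite mulrCA.
Qed.

(** The factor [Q / 2] leaves room for the inhomogeneous term, which grows at
    the same rate [Q ^ j] as the bound. *)
Lemma halving_recursion_le (N : nat -> R) (Q C : R) : 1 <= Q -> 0 <= C ->
  N 0%N <= 1 -> (forall j, N j.+1 <= Q / 2 * N j + C * Q ^+ j) ->
  forall j, N j <= (1 + 2 * C) * Q ^+ j.
Proof.
move=> Q1 C0 N0 rec; elim=> [|j IH]; first by rewrite expr0; lra.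
have Qj : 0 <= Q ^+ j by rewrite exprn_ge0//; lra.
rewrite (le_trans (rec j))// exprS.
have h : Q / 2 * N j <= Q / 2 * ((1 + 2 * C) * Q ^+ j).
  by rewrite ler_wpM2l//; lra.
have h2 : C * Q ^+ j <= C * (Q * Q ^+ j).
  by rewrite ler_wpM2l// ler_peMl.
have h3 : 0 <= Q * Q ^+ j by rewrite mulr_ge0//; lra.
move: h h2 h3; set X := Q ^+ j; nra.
Qed.
(** A bound along the powers of one integer [n ^ l] is enough: the first of
    these powers that exceeds [M ^ p] exceeds it by a factor of at most
    [n ^ l]. *)
Lemma upper_minkowski_dim_le_powers A (d C : R) (n l M : nat) :
  A `<=` `[0, 1] -> (1 < n)%N -> (2 <= M)%N -> (0 < l)%N -> 0 <= d -> 0 < C ->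
  (forall j, (adic_count n (j * l) A)%:R <= C * (n%:R ^+ (j * l)) `^ d) ->
  (upper_minkowski_dim M A <= d%:E)%E.
Proof.
move=> A01 n1 M2 l0 d0 C0 hC; have n_gt0 : (0 < n)%N by exact: ltnW.
have q1 : (1 < n ^ l)%N by rewrite -(expn0 n) ltn_exp2l.
have nl0 : 0 < n%:R ^+ l :> R by rewrite exprn_gt0// ltr0n.
apply: (@upper_minkowski_dim_le _ _ _ (2 * C * (n%:R ^+ l) `^ d)) => //.
  by rewrite !mulr_gt0// powR_gt0.
move=> p; have M0 : (0 < M)%N by exact: ltnW.
(* The first power of [n ^ l] that is at least [M ^ p]. *)
pose j := up_log (n ^ l) (M ^ p).
have jM : (M ^ p <= n ^ (j * l))%N by rewrite mulnC expnM up_logP.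
have Mj : (n ^ (j * l) <= n ^ l * M ^ p)%N.
  rewrite mulnC expnM /j; have [le1|gt1] := leqP (M ^ p) 1.
    have -> : up_log (n ^ l) (M ^ p) = 0%N.
      by apply/eqP; rewrite up_log_eq0 le1 orbT.
    by rewrite expn0 muln_gt0 !expn_gt0 n_gt0 M0.
  rewrite -[X in ((n ^ l) ^ X)%N]prednK ?up_log_gt0 ?q1// expnS leq_mul2l.
  by rewrite ltnW ?orbT// up_log_gtn.
have := adic_count_change_base M0 n_gt0 A01 jM.
rewrite -(ler_nat R) natrM => /le_trans; apply.
rewrite -!mulrA ler_wpM2l// (le_trans (hC j))// ler_wpM2l ?(ltW C0)//.
rewrite -powRM ?exprn_ge0 ?(ltW nl0)//.
apply: ge0_ler_powR => //; rewrite ?nnegrE ?mulr_ge0 ?exprn_ge0//.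
by rewrite -!natrX -natrM ler_nat.
Qed.

End GrowthAndDimension.

(** * The zigzag function *)

Section Zigzag.
Variables (R : realType) (m r : nat).
Hypotheses (m_gt1 : (1 < m)%N) (r_odd : odd r).

Let n := (m * r)%N.

Let r_gt0 : (0 < r)%N. Proof. by case: r r_odd. Qed.
Let m_gt0 : (0 < m)%N. Proof. exact: ltnW. Qed.
Let n_gt0 : (0 < n)%N. Proof. by rewrite muln_gt0 m_gt0. Qed.
Let m_le_n : (m <= n)%N.
Proof. by rewrite /n -[leqLHS]muln1 leq_mul2l r_gt0 orbT. Qed.
Let n_gt1 : (1 < n)%N. Proof. exact: leq_trans m_le_n. Qed.
Let m0 : 0 < m%:R :> R. Proof. by rewrite ltr0n. Qed.
Let n0 : 0 < n%:R :> R. Proof. by rewrite ltr0n. Qed.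

(** The vertical part of the [i]-th affine map: the step number [i] crosses the
    strip number [i %/ r], and it descends if it has an odd number inside this
    strip. *)
Definition zigzag_step (i : nat) (y : R) : R :=
  ((i %/ r)%:R + (if odd (i %% r) then 1 - y else y)) / m%:R.

Lemma zigzag_step_itv i y : (i < n)%N -> 0 <= y <= 1 -> 0 <= zigzag_step i y <= 1.
Proof.
move=> ilt /andP[y0 y1]; rewrite /zigzag_step.
have h : (i %/ r).+1%:R <= m%:R :> R by rewrite ler_nat ltn_divLR.
rewrite divr_ge0 ?ler_pdivrMr ?mul1r//=.
  by rewrite (le_trans _ h)// -natr1 lerD2l; case: ifP => _; lra.
by apply: addr_ge0 => //; case: ifP => _; lra.
Qed.

Lemma zigzag_step_dist i y z :
  `|zigzag_step i y - zigzag_step i z| = `|y - z| / m%:R.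
Proof.
rewrite /zigzag_step -mulrBl normrM (gtr0_norm (x := _^-1)) ?invr_gt0//.
by congr (_ / _); case: ifP => _; [rewrite -normrN|]; congr `|_|; ring.
Qed.

(** Inside a strip the direction changes, so that consecutive steps meet at the
    top or at the bottom of the strip; the last of the [r] steps of a strip goes
    up because [r] is odd, and it ends at the bottom of the next strip. *)
Lemma zigzag_step_junction i : (i < n)%N ->
  zigzag_step i.+1 0 = zigzag_step i 1.
Proof.
move=> ilt; rewrite /zigzag_step; congr (_ / _).
have ir := ltn_pmod i r_gt0.
have [lt|ge] := ltnP (i %% r).+1 r.
  have iE : i.+1 = (i %/ r * r + (i %% r).+1)%N by rewrite addnS -divn_eq.
  have -> : (i.+1 %/ r = i %/ r)%N.
    by rewrite {1}iE divnMDl// (divn_small lt) addn0.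
  have -> : (i.+1 %% r = (i %% r).+1)%N by rewrite {1}iE modnMDl modn_small.
  by rewrite /=; case: (odd _) => /=; ring.
have ire : (i %% r).+1 = r by apply/eqP; rewrite eqn_leq ir.
have iE : i.+1 = ((i %/ r).+1 * r)%N.
  by rewrite {1}(divn_eq i r) -addnS ire mulSn addnC.
rewrite iE mulnK// modnMl /=.
have /= := r_odd; rewrite -{1}ire /= => /negbTE ->.
by rewrite -natr1; ring.
Qed.

(** Iterates of the functional equation [zigzag_unfold], which express the value
    at [x] by the value at the fractional part of [n * x].  At [x = 1] the
    truncation is [n], a step beyond the last one, of which only the starting
    point is used, see [zigzag_step_last]. *)
Fixpoint zigzag_approx (k : nat) (x : R) : R :=
  if k is k'.+1 then
    zigzag_step (Num.truncn (n%:R * x))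
      (zigzag_approx k' (n%:R * x - (Num.truncn (n%:R * x))%:R))
  else 0.

Definition zigzag (x : R) : R := limn (zigzag_approx ^~ x).

Lemma frac_itv (x : R) : 0 <= x ->
  0 <= n%:R * x - (Num.truncn (n%:R * x))%:R < 1.
Proof.
move=> x0; have h : 0 <= n%:R * x by rewrite mulr_ge0.
by have /andP[] := truncn_itv h; rewrite -natr1 => ? ?; lra.
Qed.

Lemma zigzag_approx0 k : zigzag_approx k 0 = 0.
Proof.
elim: k => //= k IH.
by rewrite mulr0 truncn0 subr0 IH /zigzag_step div0n mod0n /= addr0 mul0r.
Qed.

Lemma zigzag_step_last : zigzag_step n 0 = 1.
Proof.
by rewrite /zigzag_step mulnK// modnMl /= addr0 divff// gt_eqF.
Qed.

Lemma zigzag_approx_itv k x : 0 <= x <= 1 -> 0 <= zigzag_approx k x <= 1.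
Proof.
elim: k x => [|k IH] x /andP[x0 x1] /=; first by rewrite lexx ler01.
have [x1'|x1'] := eqVneq x 1.
  rewrite x1' mulr1 natrK subrr zigzag_approx0 zigzag_step_last; lra.
have /andP[? ?] := frac_itv x0.
apply: zigzag_step_itv; last by apply: IH; lra.
rewrite truncn_lt_nat ?mulr_ge0// gtr_pMr//.
by rewrite lt_neqAle x1'.
Qed.

(** Each unfolding contracts vertical distances by the factor [1 / m]. *)
Lemma zigzag_approx_cauchy k x : 0 <= x <= 1 ->
  `|zigzag_approx k.+1 x - zigzag_approx k x| <= (m%:R^-1) ^+ k.
Proof.
elim: k x => [|k IH] x xI.
  rewrite expr0 [zigzag_approx 0 x]/= subr0.
  by have /andP[? ?] := zigzag_approx_itv 1 xI; rewrite ger0_norm.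
have /andP[? ?] := frac_itv (proj1 (andP xI)).
rewrite [zigzag_approx k.+2 x]/= [zigzag_approx k.+1 x]/= zigzag_step_dist.
by rewrite exprS mulrC ler_wpM2l ?invr_ge0//; apply: IH; lra.
Qed.

Lemma zigzag_approx_cvg x : 0 <= x <= 1 -> cvgn (zigzag_approx ^~ x).
Proof.
move=> xI; pose d k := zigzag_approx k.+1 x - zigzag_approx k x.
have -> : (zigzag_approx ^~ x) = series d.
  apply/funext => k; rewrite /series /= telescope_sumr//.
  by rewrite [zigzag_approx 0 x]/= subr0.
apply: normed_cvg; apply: (@series_le_cvg _ _ (geometric 1 (m%:R^-1))).
- by move=> k; exact: normr_ge0.
- by move=> k /=; rewrite mul1r exprn_ge0 ?invr_ge0.
- by move=> k /=; rewrite mul1r; exact: zigzag_approx_cauchy.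
- apply: is_cvg_geometric_series.
  by rewrite gtr0_norm ?invr_gt0// invf_lt1// ltr1n.
Qed.

Lemma zigzag_itv x : 0 <= x <= 1 -> 0 <= zigzag x <= 1.
Proof.
move=> xI; have c := zigzag_approx_cvg xI; apply/andP; split.
  apply: limr_ge => //; apply: nearW => k.
  by have /andP[] := zigzag_approx_itv k xI.
apply: limr_le => //; apply: nearW => k.
by have /andP[] := zigzag_approx_itv k xI.
Qed.

Lemma zigzag_unfold x : 0 <= x <= 1 ->
  zigzag x = zigzag_step (Num.truncn (n%:R * x))
    (zigzag (n%:R * x - (Num.truncn (n%:R * x))%:R)).
Proof.
move=> xI; have /andP[? ?] := frac_itv (proj1 (andP xI)).
set t := Num.truncn _; set y := _ - _.
have yI : 0 <= y <= 1 by rewrite /y /t; lra.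
have lim_next : zigzag_approx k.+1 x @[k --> \oo] --> zigzag_step t (zigzag y).
  rewrite /= -/t -/y /zigzag_step.
  apply: cvgMl; apply: cvgD; first exact: cvg_cst.
  case: ifP => _; last exact: zigzag_approx_cvg.
  by apply: cvgB; [exact: cvg_cst|exact: zigzag_approx_cvg].
move: lim_next; rewrite (cvg_shiftS (zigzag_approx ^~ x)) => lim_x.
exact: (cvg_lim _ lim_x).
Qed.

Lemma zigzag0 : zigzag 0 = 0.
Proof.
rewrite /zigzag; apply/cvg_lim => //.
by under eq_fun do rewrite zigzag_approx0; exact: cvg_cst.
Qed.

Lemma zigzag1 : zigzag 1 = 1.
Proof.
by rewrite zigzag_unfold ?ler01 ?lexx// mulr1 natrK subrr zigzag0
  zigzag_step_last.
Qed.

(** For [x < 1] this is the functional equation; at [x = 1], where the equation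
    uses the next step, it holds because consecutive steps join. *)
Lemma zigzag_self_affine i x : (i < n)%N -> 0 <= x <= 1 ->
  zigzag ((i%:R + x) / n%:R) = zigzag_step i (zigzag x).
Proof.
move=> ilt /andP[x0 x1].
have in' : i.+1%:R <= n%:R :> R by rewrite ler_nat.
have nE y : n%:R * (y / n%:R) = y :> R by rewrite mulrC divfK// gt_eqF.
have i0 : 0 <= i%:R :> R by [].
rewrite zigzag_unfold; last first.
  rewrite divr_ge0 ?addr_ge0//= ler_pdivrMr// mul1r.
  by rewrite -natr1 in in'; lra.
rewrite nE; have [->|x1'] := eqVneq x 1.
  by rewrite natr1 natrK subrr zigzag0 zigzag1 zigzag_step_junction.
have -> : Num.truncn (i%:R + x) = i.
  apply: truncn_def; rewrite -natr1.
  by move: x1' x1; rewrite le_eqVlt => /negbTE -> /= ?; lra.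
by rewrite addrAC subrr add0r.
Qed.

(** ** Self-similarity at every level *)

Lemma unit_subinterval (k p : nat) (x : R) : (p < n ^ k)%N -> 0 <= x <= 1 ->
  0 <= (p%:R + x) / n%:R ^+ k <= 1.
Proof.
move=> plt /andP[x0 x1].
have nk0 : 0 < n%:R ^+ k :> R by rewrite exprn_gt0.
rewrite divr_ge0 ?addr_ge0 ?(ltW nk0)//= ler_pdivrMr// mul1r.
have : p.+1%:R <= (n ^ k)%:R :> R by rewrite ler_nat.
by rewrite natrX -natr1; lra.
Qed.

(** Above its column of level [k] the graph is an affine copy of the whole graph
    inside a single strip of height [m ^ -k]. *)
Lemma zigzag_column k p (x : R) : (p < n ^ k)%N -> 0 <= x <= 1 ->
  zigzag ((p%:R + x) / n%:R ^+ k) =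
  ((column_row m r k p)%:R +
     (if column_flip m r k p then 1 - zigzag x else zigzag x)) / m%:R ^+ k.
Proof.
elim: k p => [|k IH] p.
  by rewrite expn0 ltnS leqn0 => /eqP -> _ /=; rewrite !expr0 !add0r !divr1.
move=> plt xI /=.
have nk0 : (0 < n ^ k)%N by rewrite expn_gt0 n_gt0.
have pl := ltn_pmod p nk0.
have il : (p %/ n ^ k < n)%N by rewrite ltn_divLR// -expnS.
have nkr : n%:R ^+ k != 0 :> R by rewrite expf_neq0// gt_eqF.
have mkr : m%:R ^+ k != 0 :> R by rewrite expf_neq0// gt_eqF.
have -> : (p%:R + x) / n%:R ^+ k.+1 =
    ((p %/ n ^ k)%:R + ((p %% n ^ k)%:R + x) / n%:R ^+ k) / n%:R.
  rewrite {1}(divn_eq p (n ^ k)) natrD natrM natrX exprS.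
  by field; rewrite (gt_eqF n0).
rewrite zigzag_self_affine//; last exact: unit_subinterval.
rewrite IH// /zigzag_step -/n.
have := column_row_lt m_gt1 r_gt0 pl; rewrite -/n.
set c := column_row _ _ _ _ => clt.
have cE : ((m ^ k).-1 - c)%:R = m%:R ^+ k - 1 - c%:R :> R.
  rewrite natrB; last by lia.
  by congr (_ - _); rewrite -natrX -subn1 natrB// expn_gt0 m_gt0.
case: (odd _) => /=; case: (column_flip _ _ _ _) => /=;
  rewrite ?natrD ?natrM ?cE natrX exprS; field; rewrite ?mkr ?(gt_eqF m0)//.
Qed.

Lemma zigzag_column_dist k p (x y : R) : (p < n ^ k)%N ->
  0 <= x <= 1 -> 0 <= y <= 1 ->
  `|zigzag ((p%:R + x) / n%:R ^+ k) - zigzag ((p%:R + y) / n%:R ^+ k)| =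
  `|zigzag x - zigzag y| / m%:R ^+ k.
Proof.
move=> plt xI yI; rewrite !zigzag_column// -mulrBl normrM normfV.
rewrite (ger0_norm (exprn_ge0 _ (ltW m0))); congr (_ / _).
by case: ifP => _; [rewrite -normrN|]; congr `|_|; ring.
Qed.

(** ** Hölder continuity *)

Lemma column_of_lt1 k (x : R) : 0 <= x < 1 ->
  exists p t, [/\ (p < n ^ k)%N, 0 <= t < 1 & x = (p%:R + t) / n%:R ^+ k].
Proof.
move=> /andP[x0 x1]; have nk0 : 0 < n%:R ^+ k :> R by rewrite exprn_gt0.
have h : 0 <= n%:R ^+ k * x by rewrite mulr_ge0// ltW.
exists (Num.truncn (n%:R ^+ k * x)),
  (n%:R ^+ k * x - (Num.truncn (n%:R ^+ k * x))%:R).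
split.
- by rewrite truncn_lt_nat// natrX gtr_pMr.
- by have /andP[] := truncn_itv h; rewrite -natr1 => ? ?; lra.
- by rewrite addrC subrK mulrAC divff ?mul1r// gt_eqF.
Qed.

Lemma column_of k (x : R) : 0 <= x <= 1 ->
  exists p t, [/\ (p < n ^ k)%N, 0 <= t <= 1 & x = (p%:R + t) / n%:R ^+ k].
Proof.
move=> /andP[x0]; rewrite le_eqVlt => /predU1P[->|x1].
  have nk0 : (0 < n ^ k)%N by rewrite expn_gt0 n_gt0.
  exists (n ^ k).-1, 1; split; rewrite ?prednK ?ler01 ?lexx//.
  by rewrite natr1 prednK// natrX divff// expf_neq0// gt_eqF.
have [|p [t [pl /andP[t0 t1] xE]]] := @column_of_lt1 k x; first by rewrite x0.
by exists p, t; rewrite t0 (ltW t1).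
Qed.

Lemma zigzag_column_osc k p (x y : R) : (p < n ^ k)%N ->
  0 <= x <= 1 -> 0 <= y <= 1 ->
  `|zigzag ((p%:R + x) / n%:R ^+ k) - zigzag ((p%:R + y) / n%:R ^+ k)|
    <= m%:R ^- k.
Proof.
move=> plt xI yI; rewrite zigzag_column_dist// ler_pdivrMr ?exprn_gt0//.
rewrite mulVf ?expf_neq0 ?gt_eqF//.
have /andP[? ?] := zigzag_itv xI.
have /andP[? ?] := zigzag_itv yI.
by rewrite ler_norml; apply/andP; split; lra.
Qed.

(** Two points at distance at most [n ^ -k] lie in one column of level [k] or in
    two adjacent ones, and over each column the function varies by at most
    [m ^ -k]. *)
Lemma zigzag_osc k (x y : R) : 0 <= x -> x <= y -> y <= 1 ->
  y - x <= n%:R ^- k -> `|zigzag x - zigzag y| <= 2 * m%:R ^- k.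
Proof.
move=> x0; rewrite le_eqVlt => /predU1P[-> _ _|xy y1 yx].
  by rewrite subrr normr0 mulr_ge0// invr_ge0 exprn_ge0.
have [|p [t [plt /andP[t0 t1] xE]]] := @column_of_lt1 k x.
  by rewrite x0/= (lt_le_trans xy).
have nk0 : 0 < n%:R ^+ k :> R by rewrite exprn_gt0.
have mk0 : 0 <= m%:R ^- k :> R by rewrite invr_ge0 exprn_ge0.
pose u := y * n%:R ^+ k; have yE : y = u / n%:R ^+ k by rewrite /u mulfK ?gt_eqF.
have xu : p%:R + t < u by rewrite -(@ltr_pM2r _ (n%:R ^- k)) ?invr_gt0// -xE -yE.
have ux : u <= p%:R + t + 1.
  rewrite -(@ler_pM2r _ (n%:R ^- k)) ?invr_gt0// -yE mulrDl -xE mul1r; lra.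
have tI : 0 <= t <= 1 by rewrite t0 ltW.
(* In units of [n ^ -k], [x] lies in the column [p] and [y] has the coordinate
   [u <= p + 2], hence lies in the column [p] or in the next one. *)
have [up|pu] := leP u (p%:R + 1).
  have -> : y = (p%:R + (u - p%:R)) / n%:R ^+ k by rewrite addrC subrK.
  rewrite xE (le_trans (zigzag_column_osc plt tI _)) //; last by lra.
  by apply/andP; split; lra.
have plt' : (p.+1 < n ^ k)%N.
  rewrite -(ltr_nat R) -natr1 (lt_le_trans pu)// natrX /u.
  by rewrite ger_pMl.
have yE' : y = (p.+1%:R + (u - p.+1%:R)) / n%:R ^+ k.
  by rewrite addrC subrK.
have I0 : 0 <= (0 : R) <= 1 by rewrite lexx ler01.
have I1 : 0 <= (1 : R) <= 1 by rewrite lexx ler01.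
have uI : 0 <= u - p.+1%:R <= 1 by rewrite -natr1; apply/andP; split; lra.
have h1 := zigzag_column_osc plt tI I1.
have h2 := zigzag_column_osc plt' I0 uI.
rewrite -xE natr1 in h1; rewrite -yE' addr0 in h2.
rewrite (le_trans (ler_distD _ _ _) (le_trans (lerD h1 h2) _))//.
lra.
Qed.

Lemma zigzag_holder (alpha : R) : 0 < alpha -> n%:R `^ alpha = m%:R ->
  holder_on `[0, 1] alpha zigzag.
Proof.
move=> a0 nam; exists (2 * m%:R); first by rewrite mulr_gt0.
move=> x y; wlog xy : x y / x <= y.
  move=> H X Y; case/orP: (le_total x y) => xy; first exact: H.
  by rewrite distrC (distrC x); apply: H.
rewrite /= !in_itv/= => /andP[x0 _] /andP[_ y1].
move: xy; rewrite le_eqVlt => /predU1P[->|xy].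
  by rewrite subrr normr0 mulr_ge0 ?powR_ge0 ?mulr_ge0.
have d0 : 0 < y - x by lra.
(* The level [k] such that [n ^ -(k + 1) <= y - x <= n ^ -k]. *)
pose T := Num.truncn ((y - x)^-1).
have dV0 : 0 <= (y - x)^-1 by rewrite invr_ge0 ltW.
have /andP[T1 T2] := truncn_itv dV0.
have T0 : (0 < T)%N by rewrite truncn_gt0 invf_ge1//; lra.
have /andP[k1 k2] := trunc_log_bounds n_gt1 T0.
set k := trunc_log n T in k1 k2.
have nk0 j : 0 < n%:R ^+ j :> R by rewrite exprn_gt0.
have dk : y - x <= n%:R ^- k.
  rewrite -[leLHS]invrK lef_pV2 ?posrE ?invr_gt0// (le_trans _ T1)//.
  by rewrite -natrX ler_nat.
have kd : n%:R ^- k.+1 <= y - x.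
  rewrite -[leRHS]invrK lef_pV2 ?posrE ?invr_gt0// (le_trans (ltW T2))//.
  by rewrite -natrX ler_nat.
apply: (le_trans (zigzag_osc x0 (ltW xy) y1 dk)).
rewrite -mulrA ler_wpM2l//.
have -> : m%:R ^- k = m%:R * m%:R ^- k.+1 :> R.
  by rewrite exprS invfM mulrA divff ?mul1r// gt_eqF.
rewrite ler_wpM2l ?(ltW m0)//.
have -> : m%:R ^- k.+1 = (n%:R ^- k.+1) `^ alpha.
  rewrite -[in RHS]powR_inv1 ?exprn_ge0// -powRrM mulN1r powRN; congr (_^-1).
  by rewrite -[in RHS]powR_mulrn// powRAC nam powR_mulrn.
rewrite distrC (ger0_norm (ltW d0)).
by apply: ge0_ler_powR => //; rewrite ?nnegrE ?invr_ge0 ?exprn_ge0 // ltW.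
Qed.

(** ** The self-affine graph *)

Definition zigzag_map (i : nat) (v : 'cV[R]_2) : 'cV[R]_2 :=
  \col_a (if a == 0 then (i%:R + v 0 0) / n%:R else zigzag_step i (v 1 0)).

Lemma zigzag_map_affine i : affine_map (zigzag_map i).
Proof.
pose flip : R := if odd (i %% r) then -1 else 1.
pose shift : R := if odd (i %% r) then 1 else 0.
exists (diag_mx (\row_a (if a == 0 then n%:R^-1 else flip / m%:R))),
  (\col_a (if a == 0 then i%:R / n%:R else ((i %/ r)%:R + shift) / m%:R)) => v.
apply/colP => a; rewrite mul_diag_mx !mxE /zigzag_step /flip /shift.
case: a => [[|[|a]] ha] //=.
  have -> : v (Ordinal ha) 0 = v 0 0 by congr (v _ _); apply/val_inj.
  by field; rewrite gt_eqF.
have -> : v (Ordinal ha) 0 = v 1 0 by congr (v _ _); apply/val_inj.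
by case: ifP => _; field; rewrite gt_eqF.
Qed.

Lemma zigzag_map_inj i : injective (zigzag_map i).
Proof.
move=> u v uv; apply/colP => a.
have E b : zigzag_map i u b 0 = zigzag_map i v b 0 by rewrite uv.
case: a => [[|[|a]] ha] //=.
  have := E 0; rewrite !mxE /= => /(mulIf (lt0r_neq0 _)) h.
  have -> : Ordinal ha = 0 by apply/val_inj.
  by apply: (addrI i%:R); apply: h; rewrite invr_gt0.
have -> : Ordinal ha = 1 by apply/val_inj.
have := E 1; rewrite !mxE /= => /eqP; rewrite -subr_eq0 -normr_eq0.
rewrite zigzag_step_dist// mulf_eq0 normr_eq0 subr_eq0 invr_eq0.
by rewrite (gt_eqF m0) orbF => /eqP.
Qed.

(** The horizontal ratio [1 / n] is at most the vertical one, because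
    [m <= n]. *)
Lemma zigzag_map_contractive i : contractive_map (zigzag_map i).
Proof.
exists m%:R^-1; rewrite invr_ge0 ltW//= invf_lt1// ltr1n; split => // u v.
have mV0 : 0 <= m%:R^-1 :> R by rewrite invr_ge0 ltW.
have nV : n%:R^-1 <= m%:R^-1 :> R by rewrite lef_pV2 ?posrE// ler_nat.
rewrite /euclidean_norm -[X in X * _](ger0_norm mV0) -sqrtr_sqr.
rewrite -sqrtrM ?sqr_ge0//.
rewrite ler_wsqrtr// !big_ord_recl !big_ord0 !addr0 mulrDr !mxE /=.
apply: lerD.
  rewrite -mulrBl opprD addrACA subrr add0r exprMn mulrC.
  by rewrite ler_wpM2r ?sqr_ge0// ler_sqr ?nnegrE// invr_ge0 ltW.
rewrite -[leLHS]real_normK ?num_real// zigzag_step_dist// exprMn mulrC.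
have -> : lift ord0 ord0 = 1 :> 'I_2 by apply/val_inj.
by rewrite real_normK ?num_real.
Qed.

Lemma zigzag_graph_self_affine :
  unit_graph zigzag =
  \bigcup_(i : 'I_n) (zigzag_map i @` unit_graph zigzag).
Proof.
apply/seteqP; split => v.
  move=> [v0 v1]; rewrite in_itv /= in v0.
  have [p [t [pl tI vE]]] := column_of 1 v0.
  rewrite expr1 in vE; rewrite expn1 in pl.
  exists (Ordinal pl) => //=.
  exists (\col_a (if a == 0 then t else zigzag t)).
    by rewrite /unit_graph /= !mxE /= in_itv.
  apply/colP => a; rewrite !mxE /=; case: a => [[|[|a]] ha] //=.
    by rewrite -vE; congr (v _ _); apply/val_inj.
  rewrite -zigzag_self_affine// -vE -v1; congr (v _ _); exact/val_inj.
move=> [[i il] _ [w [w0 w1] <-]]; rewrite in_itv /= in w0.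
rewrite /unit_graph /= !mxE /= in_itv /=; split.
  have := @unit_subinterval 1 i (w 0 0).
  by rewrite expn1 expr1; apply.
by rewrite w1 zigzag_self_affine.
Qed.

Lemma zigzag_self_affine_function :
  {within `[0, 1], continuous zigzag} ->
  self_affine_function zigzag.
Proof.
move=> cz; split => //; split; first exact: continuous_compact_unit_graph.
exists n, (fun i => zigzag_map i); split => //.
- by move=> i; split;
    [exact: zigzag_map_inj|exact: zigzag_map_contractive
    |exact: zigzag_map_affine].
- exact: zigzag_graph_self_affine.
Qed.

(** ** Counting the cells met by a restriction *)

(** In a cell that does not oscillate by [m ^ -(k + l)], the rescaled values at
    the points of [A] are all at distance less than one row of level [l] from
    the value at one of these points, so that at most [3 * r ^ l] subcells are
    met by [count_columns_near_row].  All the [n ^ l] subcells of an oscillating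
    cell are counted. *)
Lemma zigzag_adic_count_rec (A : set R) k l :
  (adic_count n (k + l) A <=
   3 * r ^ l * adic_count n k A +
   n ^ l * oscillation_count zigzag n k A (m%:R ^- (k + l)))%N.
Proof.
have nl0 : (0 < n ^ l)%N by rewrite expn_gt0 n_gt0.
have nkR j : 0 < n%:R ^+ j :> R by rewrite exprn_gt0.
have mkR j : 0 < m%:R ^+ j :> R by rewrite exprn_gt0.
rewrite !adic_countE expnD big_nat_mul /oscillation_count.
rewrite !big_distrr -big_split /=.
rewrite big_nat [leqRHS]big_nat; apply: leq_sum => p /andP[_ pl].
rewrite -{1}[(p * n ^ l)%N]add0n big_addn mulSn addnK.
set bad := `[< oscillates _ _ _ _ _ p >].
set hit := `[< A `&` adic_cell n k p !=set0 >].
have [_|/asboolP good] := boolP bad.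
  apply: leq_trans (leq_addl _ _); rewrite muln1.
  rewrite -[leqRHS]muln1 -[(n ^ l)%N in leqRHS]subn0 -sum_nat_const_nat.
  by apply: leq_sum => j _; exact: leq_b1.
rewrite muln0 addn0.
have child j (x : R) : (j < n ^ l)%N -> adic_cell n (k + l) (j + p * n ^ l) x ->
    exists s : R, 0 <= s < 1 /\ x = (p%:R + (j%:R + s) / n%:R ^+ l) / n%:R ^+ k.
  move=> jl /adic_cellP-/(_ n_gt0) /andP[h1 h2].
  exists (n%:R ^+ (k + l) * x - (j + p * n ^ l)%:R); split; first lra.
  by rewrite natrD natrM natrX exprD; field; rewrite !expf_neq0// gt_eqF.
have child_cell j (s : R) : (j < n ^ l)%N -> 0 <= s < 1 ->
    adic_cell n k p ((p%:R + (j%:R + s) / n%:R ^+ l) / n%:R ^+ k).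
  move=> jl /andP[s0 s1]; apply/(adic_cellP _ _ _ n_gt0).
  rewrite mulrC divfK ?gt_eqF// lerDl ltrD2l.
  rewrite divr_ge0 ?addr_ge0 ?(ltW (nkR _))//= ltr_pdivrMr// mul1r -natrX.
  have : j.+1%:R <= (n ^ l)%:R :> R by rewrite ler_nat.
  by rewrite -natr1; lra.
have [/asboolP[x0 [Ax0 x0p]]|/asboolP nohit] := boolP hit; last first.
  rewrite muln0 big_nat big1// => j /andP[_ jl]; apply/eqP; rewrite eqb0.
  apply/asboolP => -[x [Ax xj]]; apply: nohit; exists x; split => //.
  by have [s [sI ->]] := child _ _ jl xj; exact: child_cell.
rewrite muln1.
have /adic_cellP-/(_ n_gt0) /andP[h1 h2] := x0p.
(* [t0] is the position of [x0] inside its cell, rescaled to the unit interval;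
   rows are compared with the one that contains the value at [t0]. *)
pose t0 := n%:R ^+ k * x0 - p%:R.
have x0E : x0 = (p%:R + t0) / n%:R ^+ k.
  by rewrite /t0 addrC subrK mulrAC divff ?mul1r// gt_eqF.
have t0I : 0 <= t0 <= 1 by rewrite /t0; apply/andP; split; lra.
have /andP[y0 y1] := zigzag_itv t0I.
have Y0 : 0 <= m%:R ^+ l * zigzag t0 by rewrite mulr_ge0// ltW.
have /andP[c1 c2] := truncn_itv Y0; rewrite -natr1 in c2.
apply: (@count_columns_near_row m r m_gt1 r_gt0
  (fun j => `[< A `&` adic_cell n (k + l) (j + p * n ^ l) !=set0 >]) l
  (Num.truncn (m%:R ^+ l * zigzag t0))) => j jl /asboolP[x [Ax xj]].
have [s [sI xE]] := child _ _ jl xj.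
have xp := child_cell _ _ jl sI; rewrite -xE in xp.
have sI' : 0 <= s <= 1 by move/andP: sI => [? ?]; apply/andP; split; lra.
have tI := unit_subinterval jl sI'.
have lt : `|zigzag x - zigzag x0| < m%:R ^- (k + l).
  by rewrite ltNge; apply/negP => le; apply: good; exists x, x0.
rewrite {1}xE x0E zigzag_column_dist// exprD invfM mulrC in lt.
rewrite ltr_pM2l ?invr_gt0// in lt.
rewrite zigzag_column// -/n in lt.
have /andP[z0 z1] := zigzag_itv sI'.
move: lt; set w := (if _ then _ else _) => lt.
have wI : 0 <= w <= 1 by rewrite /w; case: ifP => _; apply/andP; split; lra.
have {}lt : `|(column_row m r l j)%:R + w - m%:R ^+ l * zigzag t0| < 1.
  rewrite -(@ltr_pM2r _ (m%:R ^- l)) ?invr_gt0// mul1r.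
  rewrite -[X in _ * X]gtr0_norm ?invr_gt0// -normrM mulrBl.
  by rewrite [m%:R ^+ l * _]mulrC mulfK ?gt_eqF.
move: lt wI; rewrite ltr_norml => /andP[l1 l2] /andP[w0 w1].
(* The inequality [c <= row + 1] between integers is obtained as [c < row + 2],
   which is all that the real bounds give. *)
rewrite -ltnS -!(ltr_nat R) natrD -!natr1.
by apply/andP; split; lra.
Qed.

(** ** Dimension of regular restrictions *)

Variable alpha : R.
Hypotheses (alpha_gt0 : 0 < alpha) (n_alpha : n%:R `^ alpha = m%:R).

Let r0 : 0 < r%:R :> R. Proof. by rewrite ltr0n. Qed.
Let n1 : 1 < n%:R :> R. Proof. by rewrite ltr1n. Qed.

(** This is how [1 - alpha] enters: each strip of level [l] is crossed by
    [r ^ l = n ^ (l * (1 - alpha))] columns. *)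
Lemma crossing_exponent : n%:R `^ (1 - alpha) = r%:R.
Proof.
rewrite powRB ?(gt_eqF n0) ?implybT// powRr1 ?(ltW n0)// n_alpha.
by rewrite /n natrM mulrAC divff ?mul1r// gt_eqF.
Qed.

(** Both terms of the recursion must grow at most like [Q ^ j] with
    [Q = n ^ (l * d)].  The second one does since [alpha * gamma <= d]; the first
    one has the ratio [3 * r ^ l], which is at most [Q / 2] for large [l] since
    [r = n ^ (1 - alpha)] and [1 - alpha < d]. *)
Lemma zigzag_adic_count_le (A : set R) (gamma d : R) : 0 <= gamma ->
  1 - alpha < d -> alpha * gamma <= d ->
  (forall l, exists2 C, 0 <= C & forall k,
    (oscillation_count zigzag n k A (m%:R ^- (k + l)))%:R
      <= C * (m%:R ^+ k) `^ gamma) ->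
  exists l C, [/\ (0 < l)%N, 0 < C &
    forall j, (adic_count n (j * l) A)%:R <= C * (n%:R ^+ (j * l)) `^ d].
Proof.
move=> g0 ad agd osc.
have x1 : 1 < n%:R `^ d / r%:R.
  rewrite ltr_pdivlMr// mul1r -crossing_exponent.
  by rewrite /powR (gt_eqF n0) ltr_expR ltr_pM2r// ln_gt0.
have [k0 hk0] := expr_eventually_gt 6 x1.
pose l := k0.+1; have [C C0 hC] := osc l.
have n_ge0 := ltW n0.
pose Q := (n%:R `^ d) ^+ l.
have rQ : 3 * r%:R ^+ l <= Q / 2.
  have := hk0 l (leqnSn _); rewrite expr_div_n ltr_pdivlMr ?exprn_gt0// -/Q.
  by set X := r%:R ^+ l; lra.
have d0 : 0 <= d by rewrite (le_trans _ agd)// mulr_ge0// ltW.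
have Q1 : 1 <= Q.
  apply: exprn_ege1; rewrite -[leLHS](powRr0 n%:R).
  by apply: ler_powR => //; exact: ltW.
have QE j : (n%:R ^+ (j * l)) `^ d = Q ^+ j.
  by rewrite exprn_powR// mulnC exprM.
have mQ j : (m%:R ^+ (j * l)) `^ gamma <= Q ^+ j.
  rewrite -QE -n_alpha -exprn_powR// -powRrM; apply: ler_powR => //.
  by apply: exprn_ege1; exact: ltW.
have nlC0 : 0 <= n%:R ^+ l * C by rewrite mulr_ge0// exprn_ge0.
exists l, (1 + 2 * (n%:R ^+ l * C)); split => //; first by lra.
move=> j; rewrite QE.
apply: (halving_recursion_le (N := fun j => (adic_count n (j * l) A)%:R)) => //.
  rewrite mul0n lern1; apply: leq_trans (max_card _) _.
  by rewrite card_ord expn0.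
move=> {}j; rewrite mulSnr.
have := zigzag_adic_count_rec A (j * l) l.
rewrite -/n -(ler_nat R) natrD [X in X + _]natrM [X in _ + X]natrM natrM !natrX.
move=> /le_trans; apply.
apply: lerD; first by rewrite ler_wpM2r.
rewrite -mulrA ler_wpM2l ?exprn_ge0//.
by rewrite (le_trans (hC _))// ler_wpM2l.
Qed.

Lemma zigzag_minkowski_dim (A : set R) (gamma : R) M : A `<=` `[0, 1] ->
  (2 <= M)%N -> 0 <= gamma ->
  (forall l, exists2 C, 0 <= C & forall k,
    (oscillation_count zigzag n k A (m%:R ^- (k + l)))%:R
      <= C * (m%:R ^+ k) `^ gamma) ->
  (upper_minkowski_dim M A <= (Num.max (1 - alpha) (alpha * gamma))%:E)%E.
Proof.
move=> A01 M2 g0 osc; apply/lee_addgt0Pr => e e0; rewrite -EFinD.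
set D := Num.max _ _.
have D1 : 1 - alpha <= D by rewrite le_max lexx.
have D2 : alpha * gamma <= D by rewrite le_max lexx orbT.
have D0 : 0 <= D by rewrite (le_trans _ D2)// mulr_ge0// ltW.
have [||l [C [l0 C0 hC]]] := @zigzag_adic_count_le A gamma (D + e) g0 _ _ osc;
  [lra|lra|].
by apply: (upper_minkowski_dim_le_powers A01 n_gt1 M2 l0 _ C0 hC); lra.
Qed.

(** In a cell of level [k] the values vary by at most [c * n ^ (- k * beta)],
    which for large [k] is less than [m ^ -(k + l) = n ^ (- k * alpha) * m ^ -l].
    The finitely many smaller levels only contribute a constant, so the growth
    exponent [gamma] of the number of oscillating cells is [0]. *)
Lemma zigzag_holder_restriction (A : set R) (beta : R) M : A `<=` `[0, 1] ->
  (2 <= M)%N -> alpha < beta -> holder_on A beta zigzag ->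
  alpha <= 1 ->
  (upper_minkowski_dim M A <= (1 - alpha)%:E)%E.
Proof.
move=> A01 M2 ab [c c0 hc] a1.
have -> : 1 - alpha = Num.max (1 - alpha) (alpha * 0).
  by rewrite mulr0 max_l// subr_ge0.
have b0 : 0 < beta by exact: lt_trans ab.
apply: zigzag_minkowski_dim => // l.
have x1 : 1 < n%:R `^ (beta - alpha).
  rewrite -[ltLHS](powRr0 n%:R) /powR (gt_eqF n0) ltr_expR.
  by rewrite ltr_pM2r ?ln_gt0// subr_gt0.
have [k0 hk0] := expr_eventually_gt (c * m%:R ^+ l) x1.
exists (n ^ k0)%:R => // k; rewrite powRr0 mulr1 ler_nat.
have [k0k|kk0] := leqP k0 k; last first.
  by rewrite (leq_trans (oscillation_count_le _ _ _ _ _))// leq_pexp2l// ltnW.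
rewrite (@holder_oscillation _ _ _ beta c)//; first exact: ltW.
have mk j : 0 < m%:R ^+ j :> R by rewrite exprn_gt0.
have nk : 0 < n%:R `^ beta ^+ k by rewrite exprn_gt0// powR_gt0.
have -> : (n%:R ^- k) `^ beta = (n%:R `^ beta ^+ k)^-1.
  rewrite -exprVn exprn_powR ?invr_ge0 ?(ltW n0)// -exprVn; congr (_ ^+ k).
  by rewrite -powR_inv1 ?(ltW n0)// -powRrM mulN1r powRN.
rewrite ltr_pdivrMr// ltr_pdivlMl// exprD.
have := hk0 k k0k; rewrite powRB ?(gt_eqF n0) ?implybT// n_alpha expr_div_n.
rewrite ltr_pdivlMr//; congr (_ < _); ring.
Qed.

Lemma zigzag_variation_restriction (A : set R) (beta : R) M : A `<=` `[0, 1] ->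
  (2 <= M)%N -> 0 < beta -> (beta_variation beta A zigzag < +oo)%E ->
  (upper_minkowski_dim M A <= (Num.max (1 - alpha) (alpha * beta))%:E)%E.
Proof.
move=> A01 M2 b0 Vfin.
have [C C0 hC] := beta_variation_oscillation n_gt0 b0 Vfin.
apply: zigzag_minkowski_dim => //; first exact: ltW.
move=> l; exists (C * (m%:R ^+ l) `^ beta); first by rewrite mulr_ge0// powR_ge0.
move=> k; have mk j : 0 < m%:R ^+ j :> R by rewrite exprn_gt0.
have h0 : 0 < m%:R ^- (k + l) :> R by rewrite invr_gt0.
rewrite -mulrA -powRM ?(ltW (mk _))// -exprD [(l + k)%N]addnC.
have := hC k _ h0; set N := oscillation_count _ _ _ _ _.
have -> : (m%:R ^- (k + l)) `^ beta = ((m%:R ^+ (k + l)) `^ beta)^-1.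
  by rewrite -powR_inv1 ?(ltW (mk _))// -powRrM mulN1r powRN.
by rewrite ler_pdivrMl ?powR_gt0// mulrC.
Qed.
End Zigzag.

(** * The exponents *)

(** A rational [q] with [0 < q < 1] has this form with [a] its numerator and
    [a + b] its denominator. *)
Lemma rationals_in_unit_interval_dense (R : realType) :
  (`]0, 1[ : set R) `<=` closure [set alpha : R | exists a b : nat,
    [/\ (0 < a)%N, (0 < b)%N & alpha = a%:R / (a + b)%:R]].
Proof.
move=> x; rewrite /= in_itv /= => /andP[x0 x1] B /nbhs_ballP[e /= e0 eB].
pose lo := Num.max 0 (x - e).
have lox : lo < x by rewrite /lo gt_max x0 ltrBlDr ltrDl.
have [q] := rat_in_itvoo lox; rewrite in_itv /= => /andP[loq qx].
have q0 : 0 < (ratr q : R) by rewrite (le_lt_trans _ loq)// le_max lexx.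
have q1 : (ratr q : R) < 1 by exact: lt_trans qx x1.
exists (ratr q); split; last first.
  apply: eB; rewrite -ball_normE /= gtr0_norm ?subr_gt0//.
  by move: loq; rewrite /lo gt_max => /andP[_]; lra.
rewrite ltr0q in q0; have {}q1 : q < 1 by rewrite -(ltr_rat R) rmorph1.
have num0 : (0 < numq q)%R by rewrite numq_gt0.
have num_lt_den : (numq q < denq q)%R.
  by rewrite -(ltr_int rat) -[ltRHS]mul1r -ltr_pdivrMr ?ltr0z// divq_num_den.
exists `|numq q|%N, (`|denq q| - `|numq q|)%N.
have num_lt_den' : (`|numq q| < `|denq q|)%N.
  by rewrite -ltz_nat !gtz0_abs.
rewrite absz_gt0 gt_eqF// subn_gt0 num_lt_den' subnKC ?(ltnW num_lt_den')//.
by split => //; rewrite /ratr !natr_absz !gtr0_norm.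
Qed.

Theorem theorem2p9 (R : realType) :
  exists Delta : set R,
    [/\ Delta `<=` `]0, 1[, `]0, 1[ `<=` closure Delta &
      forall alpha : R, Delta alpha ->
        exists f : R -> R,
          [/\ self_affine_function f,
              holder_on `[0, 1] alpha f &
              forall A : set R, A `<=` `[0, 1] ->
                (forall beta : R, alpha < beta -> holder_on A beta f ->
                   forall M : nat, (2 <= M)%N ->
                     (upper_minkowski_dim M A <= (1 - alpha)%:E)%E) /\
                (forall beta : R, 0 < beta -> (beta_variation beta A f < +oo)%E ->
                   forall M : nat, (2 <= M)%N ->
                     (upper_minkowski_dim M A
                        <= (Num.max (1 - alpha) (alpha * beta))%:E)%E)]].
Proof.
exists [set alpha : R | exists a b : nat,
  [/\ (0 < a)%N, (0 < b)%N & alpha = a%:R / (a + b)%:R]].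
have exponent_itv (a b : nat) : (0 < a)%N -> (0 < b)%N ->
    0 < (a%:R / (a + b)%:R : R) < 1.
  move=> a0 b0; rewrite divr_gt0 ?ltr0n ?addn_gt0 ?a0//=.
  rewrite ltr_pdivrMr ?ltr0n ?addn_gt0 ?a0// mul1r ltr_nat.
  by rewrite -[ltnLHS]addn0 ltn_add2l.
split.
- by move=> _ [a [b [a0 b0 ->]]]; rewrite /= in_itv /=; exact: exponent_itv.
- exact: rationals_in_unit_interval_dense.
move=> alpha [a [b [a0 b0 alphaE]]].
have /andP[alpha0 alpha1] : 0 < alpha < 1 by rewrite alphaE; exact: exponent_itv.
have m_gt1 : (1 < 3 ^ a)%N by rewrite -(expn0 3) ltn_exp2l.
have r_odd : odd (3 ^ b) by rewrite oddX orbT.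
(* [n = 3 ^ (a + b)] and [(a + b) * alpha = a]. *)
have n_alpha : (3 ^ a * 3 ^ b)%:R `^ alpha = (3 ^ a)%:R :> R.
  rewrite -expnD !natrX -!powR_mulrn// -powRrM alphaE mulrC divfK//.
  by rewrite pnatr_eq0 addn_eq0 negb_and -lt0n a0.
have holder := zigzag_holder m_gt1 r_odd alpha0 n_alpha.
exists (zigzag (3 ^ a) (3 ^ b)); split => //.
  apply: zigzag_self_affine_function => //.
  exact: holder_within_continuous holder.
move=> A A01; split=> beta hbeta hA M M2.
  exact: (zigzag_holder_restriction m_gt1 r_odd alpha0 n_alpha A01 M2
    hbeta hA (ltW alpha1)).
exact: (zigzag_variation_restriction m_gt1 r_odd alpha0 n_alpha A01 M2
  hbeta hA).
Qed.
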